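(* Let $F_{\rm c}^*$ be the critical strain of the QCL and QNL approximations, $F_{\rm a}^*=F_{\rm a}^*(\varepsilon)$ the critical strain of the atomistic model, and $F_0$ the energy-minimizing macroscopic deformation gradient. Then the relative error satisfies, as $\varepsilon=1/N\to0$, $$\left|\frac{F_{\rm a}^*-F_{\rm c}^*}{F_0-F_{\rm c}^*}\right|=\varepsilon^2\left|\frac{\pi^2\,\phi''(2F_{\rm c}^* )}{\big(\phi'''(F_{\rm c}^* )+8\phi'''(2F_{\rm c}^* )\big)(F_0-F_{\rm c}^* )}\right|+O(\varepsilon^4)=:\varepsilon^2 C_{\rm err}(\phi)+O(\varepsilon^4).$$
   Context: The interaction potential $\phi$ satisfies: (i) $\phi\in C^4((0,\infty);\mathbb{R})$; (ii) there is $r_*>0$ such that $\phi$ is convex in $(0,r_* )$ and concave in $(r_*,\infty)$; (iii) $\phi^{(k)}(r)\to0$ rapidly as $r\to\infty$ for $k=0,\dots,4$. For $N\in\mathbb{N}$ put $\varepsilon=1/N$ and $\mu_\varepsilon=2\sin(\pi\varepsilon/2)/\varepsilon$. The setting is a $2N$-periodic one-dimensional atomistic chain with nearest and next-nearest neighbour pair interactions given by $\phi$, uniformly deformed with macroscopic deformation gradient $F>0$. The critical strain $F_{\rm a}^*=F_{\rm a}^*(\varepsilon)>0$ of the atomistic model is the solution of $\phi''(F_{\rm a}^* )+(4-\varepsilon^2\mu_\varepsilon^2)\phi''(2F_{\rm a}^* )=0$. The critical strain $F_{\rm c}^*>0$ of the local quasicontinuum (QCL) and quasi-nonlocal (QNL)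 approximations is the solution (independent of $\varepsilon$) of $\phi''(F_{\rm c}^* )+4\phi''(2F_{\rm c}^* )=0$. The number $F_0>0$ is the energy-minimizing macroscopic deformation gradient (the atomistic energy per period of the uniformly deformed chain is $2(\phi(F)+\phi(2F))$), which satisfies $\phi'(F_0)+2\phi'(2F_0)=0$. *)

(* Defs.v *)
From Stdlib Require Import Reals.
From Coquelicot Require Import Coquelicot.

Open Scope R_scope.

(* Potentials are total functions R -> R, of which only the values on
   (0, +oo) matter: every condition below is imposed at positive arguments,
   and Derive_n at a positive point depends only on the values nearby. *)

Definition C_n_pos (n : nat) (f : R -> R) : Prop :=
  forall x : R, 0 < x ->
    (forall k : nat, (k <= n)%nat -> ex_derive_n f k x) /\
    continuous (Derive_n f n) x.

Definition convex_on (D : R -> Prop) (f : R -> R) : Prop :=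
  forall x y t : R, D x -> D y -> 0 <= t <= 1 ->
    f (t * x + (1 - t) * y) <= t * f x + (1 - t) * f y.

Definition concave_on (D : R -> Prop) (f : R -> R) : Prop :=
  convex_on D (fun x => - f x).

(* No rate is attached to the "rapid" decay of phi and its derivatives: only
   convergence to 0 is required, so that every rate is covered, in particular
   the algebraic one of Lennard-Jones potentials. *)
Record interaction_potential (phi : R -> R) : Prop := {
  potential_smooth : C_n_pos 4 phi;
  potential_shape : exists r_star : R, 0 < r_star /\
    convex_on (fun r => 0 < r < r_star) phi /\
    concave_on (fun r => r_star < r) phi;
  potential_decay : forall k : nat, (k <= 4)%nat ->
    is_lim (Derive_n phi k) p_infty 0
}.

Definition eps (N : nat) : R := / INR N.

Definition mu (e : R) : R := 2 * sin (PI * e / 2) / e.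

Definition critical_strain_atomistic (phi : R -> R) (N : nat) (F : R) : Prop :=
  unique (fun G => 0 < G /\
    Derive_n phi 2 G + (4 - eps N ^ 2 * mu (eps N) ^ 2) * Derive_n phi 2 (2 * G)
      = 0) F.

Definition critical_strain_qc (phi : R -> R) (F : R) : Prop :=
  unique (fun G => 0 < G /\
    Derive_n phi 2 G + 4 * Derive_n phi 2 (2 * G) = 0) F.

(* Atomistic energy per period of the chain with uniform deformation
   gradient F: the period has 2N atoms at spacing eps = 1/N, whence the
   factor 2. *)
Definition uniform_energy (phi : R -> R) (F : R) : R :=
  2 * (phi F + phi (2 * F)).

Definition energy_minimizing_gradient (phi : R -> R) (F : R) : Prop :=
  0 < F /\ forall G : R, 0 < G -> uniform_energy phi F <= uniform_energy phi G.

Definition relative_error (Fa Fc F0 : R) : R := Rabs ((Fa - Fc) / (F0 - Fc)).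

Definition C_err (phi : R -> R) (Fc F0 : R) : R :=
  Rabs (PI ^ 2 * Derive_n phi 2 (2 * Fc) /
    ((Derive_n phi 3 Fc + 8 * Derive_n phi 3 (2 * Fc)) * (F0 - Fc))).

Definition bigO_infty (u v : nat -> R) : Prop :=
  exists C : R, eventually (fun N => Rabs (u N) <= C * Rabs (v N)).

(* Main.v *)
Require Import Defs.
From Stdlib Require Import Reals Ranalysis5 Lra Lia.
From Coquelicot Require Import Coquelicot.

Open Scope R_scope.

(** Write [g G = phi'' G + 4 phi'' (2 G)], [h G = phi'' (2 G)] and
    [delta = eps^2 mu^2 = 4 sin^2 (PI eps / 2)].  The critical strain [Fc] is a
    zero of [g], nondegenerate with slope [L = phi''' Fc + 8 phi''' (2 Fc)],
    and [Fa] is a zero of the perturbation [g - delta h].  Near [Fc] one has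
    [g x = L (x - Fc) + O((x - Fc)^2)] and [h x = h Fc + O(x - Fc)]
    ([first_order_expansion], [ex_derive_lipschitz_at]), so that [g - delta h] takes opposite signs at the points
    [Fc + delta h(Fc) / L -/+ K delta^2] as soon as [K] is large and [delta]
    is small, and therefore vanishes between them ([perturbed_zero]).  There is
    only one positive zero, so this one is [Fa]: uniqueness turns a local
    existence result into the convergence [Fa -> Fc] and the expansion
    [Fa = Fc + delta h(Fc) / L + O(delta^2)].  The claim follows from
    [delta = PI^2 eps^2 + O(eps^4)] ([sin_sqr_expansion]). *)

Lemma ex_derive_lipschitz_at (f : R -> R) (a : R) :
  ex_derive f a ->
  exists M, 0 <= M /\ locally a (fun x => Rabs (f x - f a) <= M * Rabs (x - a)).
Proof.
intros [l Hl].
exists (Rabs l + 1); split; [generalize (Rabs_pos l); lra|].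
apply is_derive_Reals in Hl.
destruct (Hl 1 Rlt_0_1) as [d Hd].
exists d; intros x Hx; change R in (type of x).
change (Rabs (x - a) < d) in Hx.
destruct (Req_dec x a) as [->|Hxa].
{ replace (f a - f a) with 0 by ring; rewrite Rabs_R0.
  apply Rmult_le_pos; [generalize (Rabs_pos l); lra | apply Rabs_pos]. }
assert (Hne : x - a <> 0) by lra.
specialize (Hd (x - a) Hne Hx).
replace (a + (x - a)) with x in Hd by ring.
replace (f x - f a) with ((f x - f a) / (x - a) * (x - a)) by (field; lra).
rewrite Rabs_mult.
apply Rmult_le_compat_r; [apply Rabs_pos|].
replace ((f x - f a) / (x - a))
  with (l + ((f x - f a) / (x - a) - l)) by ring.
eapply Rle_trans; [apply Rabs_triang|]; lra.
Qed.

(** By the mean value theorem the remainder is [(f' xi - f' a) (x - a)] with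
    [xi] between [a] and [x]; differentiability of [f'] at the single point [a]
    bounds the first factor. *)
Lemma first_order_expansion (f f' : R -> R) (a : R) :
  locally a (fun x => is_derive f x (f' x)) -> ex_derive f' a ->
  exists M, 0 <= M /\
    locally a (fun x => Rabs (f x - f a - f' a * (x - a)) <= M * (x - a) ^ 2).
Proof.
intros Hf Hf'.
destruct (ex_derive_lipschitz_at f' a Hf') as [M [HM HL]].
exists M; split; [exact HM|].
destruct Hf as [d1 Hd1]; destruct HL as [d2 Hd2].
assert (Hd : 0 < Rmin d1 d2) by (apply Rmin_pos; apply cond_pos).
exists (mkposreal _ Hd); intros x Hx; change R in (type of x).
change (Rabs (x - a) < Rmin d1 d2) in Hx.
assert (Hbetween : forall t, Rmin a x <= t <= Rmax a x ->
          Rabs (t - a) <= Rabs (x - a)).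
{ intros t; unfold Rmin, Rmax; destruct (Rle_dec a x);
    unfold Rabs; destruct (Rcase_abs (t - a)), (Rcase_abs (x - a)); lra. }
assert (Hd1' := Rmin_l d1 d2); assert (Hd2' := Rmin_r d1 d2).
assert (Hder : forall t, Rmin a x <= t <= Rmax a x -> is_derive f t (f' t)).
{ intros t Ht; apply Hd1; change (Rabs (t - a) < d1).
  specialize (Hbetween t Ht); lra. }
destruct (MVT_gen f a x f') as [xi [Hxi Heq]].
{ intros t Ht; apply Hder; lra. }
{ intros t Ht; apply continuity_pt_filterlim.
  apply (ex_derive_continuous f t); exists (f' t); apply Hder; exact Ht. }
rewrite Heq.
replace (f' xi * (x - a) - f' a * (x - a))
  with ((f' xi - f' a) * (x - a)) by ring.
rewrite Rabs_mult.
assert (Hb := Hbetween xi Hxi).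
assert (Hlip : Rabs (f' xi - f' a) <= M * Rabs (xi - a)).
{ apply Hd2; change (Rabs (xi - a) < d2); lra. }
replace (M * (x - a) ^ 2) with (M * Rabs (x - a) * Rabs (x - a))
  by (rewrite <- (pow2_abs (x - a)); ring).
apply Rmult_le_compat_r; [apply Rabs_pos|].
eapply Rle_trans; [exact Hlip|].
apply Rmult_le_compat_l; [exact HM | exact Hb].
Qed.

(** The existence half of a quantitative implicit function theorem.  At the
    first-order prediction [a + delta h(a) / L] the value of [g - delta h] is
    [O(delta^2)], and moving by [K delta^2] to either side changes it by about
    [L K delta^2], which decides its sign; intermediate values do the rest.
    The neighbourhood property [P] will be positivity. *)
Lemma perturbed_zero (P : R -> Prop) (g h : R -> R) (a L Mg Mh : R) :
  L <> 0 -> 0 <= Mg -> 0 <= Mh ->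
  locally a P ->
  locally a (fun x => continuity_pt g x /\ continuity_pt h x) ->
  locally a (fun x => Rabs (g x - L * (x - a)) <= Mg * (x - a) ^ 2) ->
  locally a (fun x => Rabs (h x - h a) <= Mh * Rabs (x - a)) ->
  exists K d0, 0 <= K /\ 0 < d0 /\ forall d, 0 < d < d0 ->
    exists x, P x /\ g x - d * h x = 0 /\
      Rabs (x - a - d * (h a / L)) <= K * d ^ 2.
Proof.
intros HL HMg HMh HP Hc Hg Hh.
assert (Hall := filter_and _ _ (filter_and _ _ HP Hc) (filter_and _ _ Hg Hh)).
destruct Hall as [r Hr].
set (c := h a / L).
(* B * d bounds the distance from a to any point of the bracketing interval. *)
set (B := Rabs c + 1).
assert (HB : 1 <= B) by (unfold B; generalize (Rabs_pos c); lra).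
assert (HaL : 0 < Rabs L) by (apply Rabs_pos_lt; exact HL).
(* E * d^2 will bound the two remainders together, and K is such that the
   linear term |L| K d^2 exceeds it by |L| d^2. *)
set (E := Mg * B ^ 2 + Mh * B).
assert (HE : 0 <= E).
{ unfold E; apply Rplus_le_le_0_compat; apply Rmult_le_pos; nra. }
set (K := E / Rabs L + 1).
assert (HKE : Rabs L * K = E + Rabs L) by (unfold K; field; lra).
assert (HK : 1 <= K).
{ unfold K; assert (0 <= E / Rabs L); [|lra].
  apply Rmult_le_pos; [exact HE | apply Rlt_le, Rinv_0_lt_compat; exact HaL]. }
assert (HK0 : 0 < / K) by (apply Rinv_0_lt_compat; lra).
assert (HB0 : 0 < r / B).
{ apply Rmult_lt_0_compat; [apply cond_pos | apply Rinv_0_lt_compat; lra]. }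
exists K, (Rmin (/ K) (r / B)); split; [lra|]; split; [apply Rmin_pos; assumption|].
intros d [Hd0 Hd].
assert (HKd : K * d <= 1).
{ assert (d <= / K) by (generalize (Rmin_l (/ K) (r / B)); lra).
  replace 1 with (K * / K) by (field; lra).
  apply Rmult_le_compat_l; lra. }
assert (HBd : B * d < r).
{ assert (d < r / B) by (generalize (Rmin_r (/ K) (r / B)); lra).
  replace (pos r) with (B * (r / B)) by (field; lra).
  apply Rmult_lt_compat_l; lra. }
assert (Hclose : forall x, Rabs (x - a - d * c) <= K * d ^ 2 ->
          Rabs (x - a) <= B * d).
{ intros x Hx.
  replace (x - a) with ((x - a - d * c) + d * c) by ring.
  eapply Rle_trans; [apply Rabs_triang|].
  rewrite Rabs_mult, (Rabs_pos_eq d) by lra.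
  unfold B; nra. }
assert (Hnear : forall x, Rabs (x - a - d * c) <= K * d ^ 2 ->
   (P x /\ continuity_pt g x /\ continuity_pt h x) /\
   (Rabs (g x - L * (x - a)) <= Mg * (x - a) ^ 2 /\
    Rabs (h x - h a) <= Mh * Rabs (x - a))).
{ intros x Hx; apply Hr; change (Rabs (x - a) < r).
  specialize (Hclose x Hx); lra. }
assert (Hlin : forall x, Rabs (x - a - d * c) <= K * d ^ 2 ->
   Rabs (g x - d * h x - L * (x - a - d * c)) <= E * d ^ 2).
{ intros x Hx.
  destruct (Hnear x Hx) as [_ [H1 H2]]; assert (H3 := Hclose x Hx).
  replace (g x - d * h x - L * (x - a - d * c))
    with ((g x - L * (x - a)) + - (d * (h x - h a)))
    by (unfold c; field; exact HL).
  eapply Rle_trans; [apply Rabs_triang|].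
  rewrite Rabs_Ropp, Rabs_mult, (Rabs_pos_eq d) by lra.
  assert (H4 : (x - a) ^ 2 <= (B * d) ^ 2).
  { rewrite <- (pow2_abs (x - a)); apply pow_incr; split;
      [apply Rabs_pos | exact H3]. }
  assert (H5 : Mg * (x - a) ^ 2 <= Mg * (B * d) ^ 2)
    by (apply Rmult_le_compat_l; assumption).
  assert (H6 : Mh * Rabs (x - a) <= Mh * (B * d))
    by (apply Rmult_le_compat_l; assumption).
  assert (H7 : d * Rabs (h x - h a) <= d * (Mh * (B * d)))
    by (apply Rmult_le_compat_l; lra).
  unfold E; nra. }
assert (Hd2 : 0 < d ^ 2) by (apply pow_lt; exact Hd0).
(* Multiplying by L makes the sign change increasing for either sign of L. *)
assert (Hsign : forall x s, Rabs s = 1 -> x - a - d * c = s * (K * d ^ 2) ->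
   Rabs (L * (g x - d * h x) - s * (L ^ 2 * K * d ^ 2)) < L ^ 2 * K * d ^ 2).
{ intros x s Hs Hx.
  assert (Hx' : Rabs (x - a - d * c) <= K * d ^ 2).
  { rewrite Hx, Rabs_mult, Hs, Rabs_pos_eq; nra. }
  assert (H := Hlin x Hx').
  replace (L * (g x - d * h x) - s * (L ^ 2 * K * d ^ 2))
    with (L * (g x - d * h x - L * (x - a - d * c))) by (rewrite Hx; ring).
  rewrite Rabs_mult.
  apply Rle_lt_trans with (Rabs L * (E * d ^ 2)).
  { apply Rmult_le_compat_l; lra. }
  replace (L ^ 2 * K * d ^ 2) with (Rabs L * ((Rabs L * K) * d ^ 2))
    by (rewrite <- (pow2_abs L); ring).
  rewrite HKE; apply Rmult_lt_compat_l; nra. }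
assert (Hin : forall x, a + d * c - K * d ^ 2 <= x <= a + d * c + K * d ^ 2 ->
          Rabs (x - a - d * c) <= K * d ^ 2).
{ intros x Hx; apply Rabs_le; lra. }
destruct (IVT_interv (fun x => L * (g x - d * h x))
            (a + d * c - K * d ^ 2) (a + d * c + K * d ^ 2)) as [x [Hx Hzero]].
- intros x Hx; destruct (Hnear x (Hin x Hx)) as [[_ [H1 H2]] _].
  apply (continuity_pt_scal (fun x => g x - d * h x)).
  apply (continuity_pt_minus g (fun x => d * h x)); [exact H1|].
  apply (continuity_pt_scal h); exact H2.
- nra.
- assert (H := Hsign (a + d * c - K * d ^ 2) (-1)).
  apply Rabs_def2 in H; [lra | rewrite Rabs_left; lra | ring].
- assert (H := Hsign (a + d * c + K * d ^ 2) 1).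
  apply Rabs_def2 in H; [lra | rewrite Rabs_R1; reflexivity | ring].
- exists x; split; [|split].
  + apply (Hnear x (Hin x Hx)).
  + destruct (Rmult_integral _ _ Hzero) as [H|H]; [contradiction | exact H].
  + apply Hin; exact Hx.
Qed.

Lemma sin_sqr_expansion (x : R) :
  0 <= x <= PI -> 0 <= x ^ 2 - sin x ^ 2 <= x ^ 4.
Proof.
intros [Hx0 HxPI].
destruct (sin_bound x 0 Hx0 HxPI) as [Hlow _].
unfold sin_approx, sin_term in Hlow; simpl in Hlow.
assert (Hlow' : x - x ^ 3 / 6 <= sin x) by (simpl; lra).
assert (Hs0 := sin_ge_0 x Hx0 HxPI).
assert (Hup : sin x <= x).
{ destruct (Req_dec x 0) as [->|Hne]; [rewrite sin_0; lra|].
  apply Rlt_le, sin_lt_x; lra. }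
split; [nra|].
replace (x ^ 2 - sin x ^ 2) with ((x - sin x) * (x + sin x)) by ring.
apply Rle_trans with (x ^ 3 / 6 * (2 * x)).
{ apply Rmult_le_compat; lra. }
assert (0 <= x ^ 4) by (apply pow_le; exact Hx0); nra.
Qed.

Lemma eps_pos_le_1 (N : nat) : (1 <= N)%nat -> 0 < eps N <= 1.
Proof.
intros HN; apply le_INR in HN; simpl in HN; unfold eps.
split; [apply Rinv_0_lt_compat; lra|].
rewrite <- Rinv_1; apply Rinv_le_contravar; lra.
Qed.

Lemma eps_mu_sqr_expansion (e : R) : 0 < e <= 1 ->
  0 < e ^ 2 * mu e ^ 2 <= PI ^ 2 * e ^ 2 /\
  Rabs (e ^ 2 * mu e ^ 2 - PI ^ 2 * e ^ 2) <= PI ^ 4 * e ^ 4.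
Proof.
intros He.
assert (HPI := PI_RGT_0).
assert (Hx : 0 < PI * e / 2 <= PI / 2) by nra.
replace (e ^ 2 * mu e ^ 2) with (4 * sin (PI * e / 2) ^ 2)
  by (unfold mu; field; lra).
assert (Hs : 0 < sin (PI * e / 2)) by (apply sin_gt_0; lra).
assert (Hb : 0 <= PI * e / 2 <= PI) by lra.
apply sin_sqr_expansion in Hb.
assert (H4 : 0 < PI ^ 4 * e ^ 4) by (apply Rmult_lt_0_compat; apply pow_lt; lra).
replace ((PI * e / 2) ^ 4) with (PI ^ 4 * e ^ 4 / 16) in Hb by field.
replace ((PI * e / 2) ^ 2) with (PI ^ 2 * e ^ 2 / 4) in Hb by field.
assert (Hs2 : 0 < sin (PI * e / 2) ^ 2) by (apply pow_lt; exact Hs).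
split; [lra | apply Rabs_le; lra].
Qed.

Lemma eps_mu_sqr_eventually_lt (d : R) : 0 < d ->
  eventually (fun N => eps N ^ 2 * mu (eps N) ^ 2 < d).
Proof.
intros Hd.
assert (HPI : 0 < PI ^ 2) by (apply pow_lt, PI_RGT_0).
assert (Hq : 0 < d / PI ^ 2)
  by (apply Rmult_lt_0_compat; [exact Hd | apply Rinv_0_lt_compat; exact HPI]).
destruct (archimed_cor1 _ Hq) as [N0 [HN0 HN0pos]].
exists N0; intros N HN.
assert (He := eps_pos_le_1 N ltac:(lia)).
assert (Hle : eps N <= / INR N0).
{ apply Rinv_le_contravar; [apply lt_0_INR; lia | apply le_INR; exact HN]. }
destruct (eps_mu_sqr_expansion (eps N) He) as [[_ H] _].
assert (Hm : PI ^ 2 * eps N < PI ^ 2 * (d / PI ^ 2))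
  by (apply Rmult_lt_compat_l; lra).
replace (PI ^ 2 * (d / PI ^ 2)) with d in Hm by (field; apply PI_neq0).
nra.
Qed.

(** The reverse triangle inequality lets the two absolute values be compared
    before they are taken; [/ (F0 - Fc)] then factors out, as
    [/ (x * y) = / x * / y] holds for all real [x] and [y]. *)
Lemma relative_error_sub_C_err_le (phi : R -> R) (F Fc F0 e : R) :
  let L := Derive_n phi 3 Fc + 8 * Derive_n phi 3 (2 * Fc) in
  Rabs (relative_error F Fc F0 - e ^ 2 * C_err phi Fc F0) <=
  Rabs (F - Fc - PI ^ 2 * e ^ 2 * (Derive_n phi 2 (2 * Fc) / L)) *
    Rabs (/ (F0 - Fc)).
Proof.
intros L; unfold relative_error, C_err; fold L.
replace (e ^ 2) with (Rabs (e ^ 2)) at 1 by (apply Rabs_pos_eq, pow2_ge_0).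
rewrite <- !Rabs_mult.
eapply Rle_trans; [apply Rabs_triang_inv2|].
apply Req_le; f_equal; unfold Rdiv; rewrite Rinv_mult; ring.
Qed.

Lemma Derive_n_is_derive (phi : R -> R) (n k : nat) (x : R) :
  C_n_pos n phi -> (k < n)%nat -> 0 < x ->
  is_derive (Derive_n phi k) x (Derive_n phi (S k) x).
Proof.
intros Hphi Hk Hx.
apply (Derive_correct (Derive_n phi k)).
apply (proj1 (Hphi x Hx) (S k)); lia.
Qed.

Lemma Derive_n_double_is_derive (phi : R -> R) (n k : nat) (x : R) :
  C_n_pos n phi -> (k < n)%nat -> 0 < x ->
  is_derive (fun G => Derive_n phi k (2 * G)) x (2 * Derive_n phi (S k) (2 * x)).
Proof.
intros Hphi Hk Hx.
apply (is_derive_comp (Derive_n phi k) (fun G => 2 * G)).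
- apply (Derive_n_is_derive phi n); [exact Hphi | exact Hk | lra].
- auto_derive; [exact I | ring].
Qed.

Lemma is_derive_continuity_pt (f : R -> R) (x l : R) :
  is_derive f x l -> continuity_pt f x.
Proof.
intros H; apply continuity_pt_filterlim, (ex_derive_continuous f x).
exists l; exact H.
Qed.

Theorem mainTheorem5 (phi : R -> R) (Fa : nat -> R) (Fc F0 : R)
  (hphi : interaction_potential phi)
  (hFa : forall N : nat, (1 <= N)%nat -> critical_strain_atomistic phi N (Fa N))
  (hFc : critical_strain_qc phi Fc)
  (hF0 : energy_minimizing_gradient phi F0)
  (hnondeg : Derive_n phi 3 Fc + 8 * Derive_n phi 3 (2 * Fc) <> 0) :
  bigO_infty
    (fun N => relative_error (Fa N) Fc F0 - eps N ^ 2 * C_err phi Fc F0)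
    (fun N => eps N ^ 4).
Proof.
assert (Hs := potential_smooth _ hphi).
destruct hFc as [[HFc Hzero] _].
set (g := fun G => Derive_n phi 2 G + 4 * Derive_n phi 2 (2 * G)).
set (g' := fun G => Derive_n phi 3 G + 8 * Derive_n phi 3 (2 * G)).
set (h := fun G => Derive_n phi 2 (2 * G)).
assert (Hpos : locally Fc (fun x => 0 < x)) by exact (open_gt 0 Fc HFc).
assert (Hg : forall x, 0 < x -> is_derive g x (g' x)).
{ intros x Hx; unfold g, g'.
  replace (8 * Derive_n phi 3 (2 * x)) with (4 * (2 * Derive_n phi 3 (2 * x)))
    by ring.
  apply (is_derive_plus (Derive_n phi 2)).
  - apply (Derive_n_is_derive phi 4); [exact Hs | lia | exact Hx].
  - apply (is_derive_scal (fun G => Derive_n phi 2 (2 * G))).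
    apply (Derive_n_double_is_derive phi 4); [exact Hs | lia | exact Hx]. }
assert (Hg' : ex_derive g' Fc).
{ apply (ex_derive_plus (Derive_n phi 3)).
  - eexists; apply (Derive_n_is_derive phi 4); [exact Hs | lia | exact HFc].
  - apply (ex_derive_scal (fun G => Derive_n phi 3 (2 * G))).
    eexists; apply (Derive_n_double_is_derive phi 4);
      [exact Hs | lia | exact HFc]. }
assert (Hh : forall x, 0 < x -> is_derive h x (2 * Derive_n phi 3 (2 * x))).
{ intros x Hx.
  apply (Derive_n_double_is_derive phi 4); [exact Hs | lia | exact Hx]. }
destruct (first_order_expansion g g' Fc) as [Mg [HMg Hgexp]].
{ apply (filter_imp (fun x => 0 < x)); [exact Hg | exact Hpos]. }
{ exact Hg'. }
destruct (ex_derive_lipschitz_at h Fc) as [Mh [HMh Hhlip]].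
{ eexists; apply Hh; exact HFc. }
destruct (perturbed_zero (fun x => 0 < x) g h Fc (g' Fc) Mg Mh)
  as [K [d0 [HK [Hd0 Hpert]]]]; try assumption.
{ apply (filter_imp (fun x => 0 < x)); [|exact Hpos].
  intros x Hx; split; eapply is_derive_continuity_pt; [apply Hg | apply Hh];
    exact Hx. }
{ revert Hgexp; apply filter_imp; intros x.
  replace (g Fc) with 0 by (symmetry; exact Hzero).
  now rewrite Rminus_0_r. }
set (c := h Fc / g' Fc) in *.
exists ((K + Rabs c) * PI ^ 4 * Rabs (/ (F0 - Fc))).
apply (filter_imp (fun N => eps N ^ 2 * mu (eps N) ^ 2 < d0 /\ (1 <= N)%nat)).
2: { apply filter_and; [apply eps_mu_sqr_eventually_lt; exact Hd0|].
     exists 1%nat; intros N HN; exact HN. }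
intros N [Hlt HN].
assert (He := eps_pos_le_1 N HN).
destruct (eps_mu_sqr_expansion (eps N) He) as [[Hdpos Hdle] Hdexp].
destruct (Hpert _ (conj Hdpos Hlt)) as [x [Hx [Hxzero Hxexp]]].
assert (HxFa : Fa N = x).
{ apply (hFa N HN); split; [exact Hx|].
  rewrite <- Hxzero; unfold g, h; ring. }
eapply Rle_trans; [apply relative_error_sub_C_err_le|].
fold (g' Fc); change (Derive_n phi 2 (2 * Fc)) with (h Fc); fold c.
rewrite HxFa.
set (d := eps N ^ 2 * mu (eps N) ^ 2) in *.
assert (He4 : 0 < eps N ^ 4) by (apply pow_lt; lra).
rewrite (Rabs_pos_eq (eps N ^ 4)) by lra.
replace ((K + Rabs c) * PI ^ 4 * Rabs (/ (F0 - Fc)) * eps N ^ 4)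
  with ((K * (PI ^ 4 * eps N ^ 4) + Rabs c * (PI ^ 4 * eps N ^ 4))
        * Rabs (/ (F0 - Fc))) by ring.
apply Rmult_le_compat_r; [apply Rabs_pos|].
replace (x - Fc - PI ^ 2 * eps N ^ 2 * c)
  with ((x - Fc - d * c) + c * (d - PI ^ 2 * eps N ^ 2)) by ring.
eapply Rle_trans; [apply Rabs_triang|].
rewrite Rabs_mult.
apply Rplus_le_compat.
- eapply Rle_trans; [exact Hxexp|].
  apply Rmult_le_compat_l; [exact HK|].
  replace (PI ^ 4 * eps N ^ 4) with ((PI ^ 2 * eps N ^ 2) ^ 2) by ring.
  apply pow_incr; lra.
- apply Rmult_le_compat_l; [apply Rabs_pos | exact Hdexp].
Qed.
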